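(* Let $n\ge 1$, let $T:\mathbb{R}^{n+1}\to\mathbb{R}^{n+1}$ be the map $(x,y)\mapsto(\bar x,\bar y)$ given by $$\bar x=f(x)+\sum_{i=1}^n y_i,\qquad \bar y_1=bx,\qquad \bar y_{i+1}=a_i y_i\quad (i=1,\dots,n-1),$$ where $|b|<1$ and $|a_i|<a<1$ for $i=1,\dots,n-1$. Let $\alpha^-<\alpha^+$ be real constants, $\alpha=\max\{|\alpha^-|,|\alpha^+|\}$, $\gamma=\dfrac{\alpha|b|}{1-a}>0$, and $D_\alpha=\{(x,y):\alpha^-<x<\alpha^+,\ \|y\|<\gamma\}$. Suppose that $$\alpha^-+\gamma\le f(x)\le \alpha^+-\gamma\qquad\text{for all } x\in(\alpha^-,\alpha^+).$$ Then the map $T$ has an attractor $A\subset D_\alpha$.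
   Context: Here $x\in\mathbb{R}$, $y=(y_1,\dots,y_n)\in\mathbb{R}^n$, and $f:\mathbb{R}\to\mathbb{R}$ is a continuous (smooth or piecewise smooth) function. The norm is $\|y\|=\sum_{i=1}^n|y_i|$. That $T$ has an attractor $A$ in a domain $D$ is understood as follows: $T(D)\subset D$ (the domain is trapping/invariant), and $A=\lim_{k\to\infty}T^kD=\bigcap_{k\ge0}T^k(D)$ is a nonempty set with $T(A)=A$.
   Formalization: The formal statement also assumes a > 0; this follows from |a_i| < a when n ≥ 2, but for n = 1 it must be added, since e.g. a = 0, b = 1/2, α^± = ±1, f = -1/2 gives an empty intersection of the T^k(D_α). *)

(* Defs.v *)
From HB Require Import structures.
From mathcomp Require Import all_boot all_order all_algebra.
From mathcomp Require Import all_classical all_reals all_analysis.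

Set Implicit Arguments.
Unset Strict Implicit.
Unset Printing Implicit Defensive.

Import Order.TTheory GRing.Theory Num.Theory.
Import numFieldNormedType.Exports.

Local Open Scope classical_set_scope.
Local Open Scope ring_scope.

(* The library norm on row vectors is the max norm, hence a separate l1 norm. *)
Definition norm1 (R : realType) (n : nat) (y : 'rV[R]_n) : R :=
  \sum_(i < n) `|y 0 i|.

(* The phase space R^(n+1) is R * R^n with n = m.+1 >= 1. With 0-based indices,
   coordinate ord0 of the new y is b * x and coordinate i+1 is a_i * y_i for
   i < m, so a family a_ : 'I_m -> R holds exactly the n - 1 coefficients. *)
Definition delay_map (R : realType) (m : nat) (f : R -> R) (b : R)
    (a_ : 'I_m -> R) (p : R * 'rV[R]_m.+1) : R * 'rV[R]_m.+1 :=
  (f p.1 + \sum_(i < m.+1) p.2 0 i,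
   \row_(j < m.+1) if unlift ord0 j is Some i
                   then a_ i * p.2 0 (widen_ord (leqnSn m) i)
                   else b * p.1).

Definition box (R : realType) (n : nat) (am ap gamma : R) :
    set (R * 'rV[R]_n) :=
  [set p | am < p.1 < ap /\ norm1 p.2 < gamma].

Definition thickening (R : realType) (X : pseudoMetricType R) (e : R)
    (A : set X) : set X :=
  \bigcup_(q in A) ball q e.

(* Convergence F k --> A for the Hausdorff distance, written without the
   distance itself (which need not be finite on arbitrary sets). *)
Definition hausdorff_cvg (R : realType) (X : pseudoMetricType R)
    (F : nat -> set X) (A : set X) : Prop :=
  forall e : R, 0 < e ->
    \forall k \near \oo, F k `<=` thickening e A /\ A `<=` thickening e (F k).

Record is_attractor (R : realType) (X : pseudoMetricType R) (T : X -> X)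
    (D A : set X) : Prop := IsAttractor {
  attractor_trapping : T @` D `<=` D;
  attractor_lim : hausdorff_cvg (fun k => iter k T @` D) A;
  attractor_bigcap : A = \bigcap_k (iter k T @` D);
  attractor_neq0 : A !=set0;
  attractor_invariant : T @` A = A
}.

(* Main.v *)
Require Import Defs.
From HB Require Import structures.
From mathcomp Require Import all_boot all_order all_algebra.
From mathcomp Require Import all_classical all_reals all_analysis.
From mathcomp Require Import lra.

Set Implicit Arguments.
Unset Strict Implicit.
Unset Printing Implicit Defensive.

Import Order.TTheory GRing.Theory Num.Theory.
Import numFieldNormedType.Exports.

Local Open Scope classical_set_scope.
Local Open Scope ring_scope.

(** The open box [D] is not compact, so the nested images [T^k D] need not be
    closed and their intersection could a priori be empty. The proof works
    instead with the closed box [K] obtained by making all inequalities weak.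

    By continuity the bounds on [f] hold on the closed interval, and [gamma] is
    the solution of [|b| alpha + a gamma = gamma]; together these make [K]
    forward invariant, and the same estimates with strict inequalities make [D]
    trapping. Moreover [T^2 K] lies in [D]. Indeed every [|a_i|] is less than
    [a], so one step brings the [l1] norm of [y] strictly below [gamma]
    ([norm1_delay_map_lt]); after that [|y_1 + ... + y_n| < gamma], and since
    [f x] stays at distance [gamma] from the end points, the next step brings
    [x] strictly inside its interval. Two steps are needed: a single one may
    still send a point of [K] to the boundary in the [x] direction.

    Hence [T^(k+2) K] is contained in [T^k D], which is contained in [T^k K],
    and everything follows from the compactness of the sets [T^k K]
    ([attractor_of_absorbing_compact]): their intersection is nonempty by
    Cantor's theorem, they converge to it in the Hausdorff sense because each
    open neighbourhood of the intersection contains one of them, and it is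
    invariant because the fibres of [T] over its points meet all of them. *)

(** * Nested compact sets *)

(** Cantor's intersection theorem: a cluster point of a sequence picking one
    point in each set lies in all of them. *)
Lemma bigcap_nested_compact_neq0 (X : topologicalType) (F : nat -> set X) :
  compact (F 0%N) -> (forall k, closed (F k)) -> (forall k, F k !=set0) ->
  (forall k l, (k <= l)%N -> F l `<=` F k) ->
  \bigcap_k F k !=set0.
Proof.
move=> F0 Fcl Fne Fdec; have /choice[x xF] : forall k, exists x, F k x by [].
have F0x : (x @ \oo) (F 0%N).
  by exists 0%N => // k _; exact: Fdec (leq0n k) _ (xF k).
have [p [_ clp]] := F0 _ _ F0x.
exists p => k _; apply: Fcl => B Bp; apply: clp Bp.
by exists k => // l kl; exact: Fdec kl _ (xF l).
Qed.

(** Otherwise the traces on the complement of [U] would be nonempty nested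
    compact sets with empty intersection. *)
Lemma nested_compact_sub_open (X : topologicalType) (F : nat -> set X)
    (U : set X) :
  compact (F 0%N) -> (forall k, closed (F k)) ->
  (forall k l, (k <= l)%N -> F l `<=` F k) ->
  open U -> \bigcap_k F k `<=` U -> exists k, F k `<=` U.
Proof.
move=> F0 Fcl Fdec Uop FU; apply: contrapT => noU.
have UCcl : closed (~` U) by exact: open_closedC.
have [||||p FUp] := @bigcap_nested_compact_neq0 X (fun k => F k `&` ~` U).
- exact: compact_closedI.
- by move=> k; exact: closedI.
- move=> k; apply: contrapT => /nonemptyPn FUk0; apply: noU; exists k.
  exact/subsets_disjoint.
- by move=> k l kl; apply: setSI; exact: Fdec.
- by have [_] := FUp 0%N I; apply; apply: FU => k _; case: (FUp k I).
Qed.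

(** * Attractors of eventually absorbed regions *)

Lemma iter_continuous (X : topologicalType) (T : X -> X) (k : nat) :
  continuous T -> continuous (iter k T).
Proof.
move=> Tc; elim: k => [|k IHk] x; first by move=> A.
by apply: (@continuous_comp _ _ _ (iter k T) T); [exact: IHk|exact: Tc].
Qed.

(** A region [D] between a forward invariant compact set [K] and one of the
    iterated images of [K] has an attractor although [D] itself need not be
    closed: the sequences [T^k D] and [T^k K] are interlaced, hence have the
    same intersection, and the latter is a nested sequence of compact sets. *)
Lemma attractor_of_absorbing_compact (R : realType) (X : pseudoMetricType R)
    (T : X -> X) (D K : set X) (N : nat) :
  hausdorff_space X -> continuous T ->
  compact K -> K !=set0 -> T @` K `<=` K ->
  D `<=` K -> T @` D `<=` D -> iter N T @` K `<=` D ->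
  exists2 A, is_attractor T D A & A `<=` D.
Proof.
move=> XH Tc Kc Kne TK DK TD KD.
pose F k := iter k T @` K.
have Fco k : compact (F k).
  apply: continuous_compact => //.
  exact/continuous_subspaceT/iter_continuous.
have Fcl k : closed (F k) by exact: compact_closed.
have Fne k : F k !=set0 by case: Kne => x Kx; exists (iter k T x), x.
have iterK k x : K x -> K (iter k T x).
  by move=> Kx; elim: k => //= k IHk; apply: TK; exists (iter k T x).
have Fdec k l : (k <= l)%N -> F l `<=` F k.
  move=> /subnKC <- _ [x Kx <-]; exists (iter (l - k) T x); first exact: iterK.
  by rewrite -iterD.
have DF k : iter k T @` D `<=` F k by exact: image_subset.
have FD k : F (k + N)%N `<=` iter k T @` D.
  move=> _ [x Kx <-]; rewrite iterD; exists (iter N T x) => //.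
  by apply: KD; exists x.
have capE : \bigcap_k F k = \bigcap_k (iter k T @` D).
  apply/seteqP; split=> x Fx k _; last exact/DF/Fx.
  exact/FD/Fx.
have F0 : compact (F 0%N) by exact: Fco.
exists (\bigcap_k F k); last first.
  by rewrite capE => x /(_ 0%N I) [y Dy <-].
split=> //.
- move=> e e0.
  (* The thickening is built from balls that may fail to be open, hence the
     interior. *)
  have capT : \bigcap_k F k `<=` (thickening e (\bigcap_k F k))°.
    move=> x Fx; apply: filterS (nbhsx_ballx x e e0) => y xy.
    by exists x.
  have [n Fn] := nested_compact_sub_open F0 Fcl Fdec (@open_interior _ _) capT.
  near=> k; split.
    apply: subset_trans (DF k) _; apply: subset_trans (Fdec n k _) _.
      by near: k; exact: nbhs_infty_ge.
    by apply: subset_trans Fn _; exact: interior_subset.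
  move=> x; rewrite capE => /(_ k I) Dx; exists x => //; exact: ballxx.
- exact: bigcap_nested_compact_neq0.
- apply/seteqP; split=> [_ [x Fx <-] k _|x Fx].
    have [y Ky yx] := Fx k I; apply: (Fdec k k.+1) => //.
    by exists y; rewrite //= yx.
  (* The fibre of [T] over [x] meets every [F k] because [x] is in [F k.+1];
     closed points make these traces a nested sequence of compact sets. *)
  have fib : closed (T @^-1` [set x]).
    apply: (iffLR (continuous_closedP T)) => //.
    exact/accessible_closed_set1/hausdorff_accessible.
  have [||||y Fy] :=
    @bigcap_nested_compact_neq0 X (fun k => F k `&` T @^-1` [set x]).
  + exact: compact_closedI.
  + by move=> k; exact: closedI.
  + move=> k; have [z Kz /= zx] := Fx k.+1 I.
    by exists (iter k T z); split=> //; exists z.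
  + by move=> k l kl; apply: setSI; exact: Fdec.
  + exists y; last by case: (Fy 0%N I).
    by move=> k _; case: (Fy k I).
Unshelve. all: by end_near. Qed.

(** * Continuity of the delay map *)

(** There are finitely many entries, so the matrix topology is the product
    topology and entrywise neighbourhoods can be intersected. *)
Lemma continuous_mx (X T : topologicalType) (m n : nat)
    (g : X -> 'M[T]_(m, n)) :
  (forall i j, continuous (fun x => g x i j)) -> continuous g.
Proof.
move=> gc x A [P gP PA]; rewrite /= nbhs_filterE.
have : \forall z \near x, forall i j, P i j (g z i j).
  by apply: filter_forall => i; apply: filter_forall => j; exact/gc/gP.
by apply: filterS => z /PA.
Qed.

Lemma continuous_sum (R : numFieldType) (X : topologicalType) (n : nat)
    (g : 'I_n -> X -> R) :
  (forall i, continuous (g i)) -> continuous (fun x => \sum_(i < n) g i x).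
Proof.
move=> gc.
by apply: continuous_big => [x|i _]; [exact: add_continuous|exact: gc].
Qed.

Lemma continuous_delay_map (R : realType) (m : nat) (f : R -> R) (b : R)
    (a_ : 'I_m -> R) :
  continuous f -> continuous (delay_map f b a_).
Proof.
move=> fc.
have fstc : continuous (fun p : R * 'rV[R]_m.+1 => p.1).
  by move=> p; exact: cvg_fst.
have coordc (j : 'I_m.+1) : continuous (fun p : R * 'rV[R]_m.+1 => p.2 0 j).
  move=> p; apply: (@continuous_comp _ _ _ snd (fun y : 'rV[R]_m.+1 => y 0 j)).
    exact: cvg_snd.
  exact: coord_continuous.
move=> p.
apply: (@cvg_pair _ _ _ _ (nbhs (delay_map f b a_ p).1)
                    (nbhs (delay_map f b a_ p).2)).
- apply: cvgD; last exact: continuous_sum.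
  by apply: continuous_comp; [exact: fstc|exact: fc].
- move: p; apply: continuous_mx => i j.
  rewrite [X in continuous X](_ : _ = fun p : R * 'rV[R]_m.+1 =>
      if unlift ord0 j is Some l then a_ l * p.2 0 (widen_ord (leqnSn m) l) else b * p.1); last first.
    by apply/funext => p; rewrite mxE.
  by case: unlift => [l|] p; apply: cvgMr; [exact: coordc|exact: fstc].
Qed.

(** * The closed box *)

Definition closed_box (R : realType) (n : nat) (am ap gamma : R) :
    set (R * 'rV[R]_n) :=
  [set p | am <= p.1 <= ap /\ norm1 p.2 <= gamma].

Lemma norm1_ge0 (R : realType) (n : nat) (y : 'rV[R]_n) : 0 <= norm1 y.
Proof. exact: sumr_ge0. Qed.

Lemma ler_sum_norm1 (R : realType) (n : nat) (y : 'rV[R]_n) :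
  `|\sum_(i < n) y 0 i| <= norm1 y.
Proof. exact: ler_norm_sum. Qed.

Lemma ler_coord_norm1 (R : realType) (n : nat) (y : 'rV[R]_n) (i : 'I_n) :
  `|y 0 i| <= norm1 y.
Proof. by rewrite /norm1 (bigD1 i) //= lerDl sumr_ge0. Qed.

Lemma norm1_continuous (R : realType) (n : nat) :
  continuous (@norm1 R n).
Proof.
apply: continuous_sum => i y.
by apply: (cvg_comp _ _ (@coord_continuous _ _ _ 0 i y)); exact: norm_continuous.
Qed.

(** Points of the [l1] ball have coordinates of size at most [gamma], so it
    is a closed subset of a finite product of segments. *)
Lemma compact_closed_box (R : realType) (n : nat) (am ap gamma : R) :
  compact (closed_box (n := n) am ap gamma).
Proof.
have -> : closed_box am ap gamma =
    `[am, ap]%classic `*` [set y : 'rV[R]_n | norm1 y <= gamma].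
  by apply/seteqP; split=> -[x y] /=; rewrite in_itv.
apply: compact_setX; first exact: segment_compact.
have ballcl : closed [set y : 'rV[R]_n | norm1 y <= gamma].
  exact: (iffLR (continuous_closedP _) (@norm1_continuous R n) _
                (@closed_le _ gamma)).
apply: (subclosed_compact ballcl
  (@rV_compact R n (fun=> `[- gamma, gamma]%classic) _)).
  by move=> i; exact: segment_compact.
move=> y /= ygamma i; rewrite in_itv /= -ler_norml.
exact: le_trans (ler_coord_norm1 y i) ygamma.
Qed.

(** The end points are handled by one-sided limits. *)
Lemma continuous_itvoo_bounds (R : realType) (f : R -> R) (u v lo hi : R) :
  continuous f -> u < v ->
  (forall x, u < x < v -> lo <= f x <= hi) ->
  forall x, u <= x <= v -> lo <= f x <= hi.
Proof.
move=> fc uv fb x /andP[ux xv].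
have Icl : closed [set z : R | z \in `[lo, hi]] by exact: interval_closed.
suff : f x \in `[lo, hi] by rewrite in_itv.
have [<-|xu] := eqVneq u x.
  apply: (closed_cvg _ Icl _ (f u) (cvg_at_right_filter (fc u))).
  near=> z; rewrite /= in_itv /=; apply: fb; apply/andP; split.
    by near: z; exact: nbhs_right_gt.
  by near: z; exact: nbhs_right_lt.
have [->|xv'] := eqVneq x v.
  apply: (closed_cvg _ Icl _ (f v) (cvg_at_left_filter (fc v))).
  near=> z; rewrite /= in_itv /=; apply: fb; apply/andP; split.
    by near: z; exact: nbhs_left_gt.
  by near: z; exact: nbhs_left_lt.
by rewrite in_itv /=; apply: fb; rewrite !lt_neqAle xu ux xv' xv.
Unshelve. all: by end_near. Qed.

(** * The delay map on the closed box *)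

Lemma norm1_delay_map (R : realType) (m : nat) (f : R -> R) (b : R)
    (a_ : 'I_m -> R) (p : R * 'rV[R]_m.+1) :
  norm1 (delay_map f b a_ p).2 =
  `|b| * `|p.1| + \sum_(i < m) `|a_ i| * `|p.2 0 (widen_ord (leqnSn m) i)|.
Proof.
rewrite /norm1 big_ord_recl mxE unlift_none normrM; congr +%R.
by apply: eq_bigr => i _; rewrite mxE liftK normrM.
Qed.

(** Strictness comes from the finitely many [|a_i|] having a maximum, which is
    still less than [a]. *)
Lemma norm1_delay_map_lt (R : realType) (m : nat) (f : R -> R) (b a : R)
    (a_ : 'I_m -> R) (alpha gamma : R) (p : R * 'rV[R]_m.+1) :
  0 < a -> (forall i, `|a_ i| < a) -> 0 < gamma ->
  `|b| * alpha + a * gamma = gamma ->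
  `|p.1| <= alpha -> norm1 p.2 <= gamma ->
  norm1 (delay_map f b a_ p).2 < gamma.
Proof.
move=> a0 a_a gamma0 gammaE palpha pgamma.
rewrite norm1_delay_map -[ltRHS]gammaE; apply: ler_ltD.
  exact: ler_wpM2l.
pose a' := \big[Num.max/0]_i `|a_ i|.
have a'0 : 0 <= a' by exact: bigmax_ge_id.
have a'a : a' < a by exact: bigmax_lt.
apply: (@le_lt_trans _ _ (a' * gamma)); last by rewrite ltr_pM2r.
apply: le_trans (ler_wpM2l a'0 pgamma).
(* The last coordinate of [p.2] is dropped by the map. *)
rewrite /norm1 big_ord_recr /= mulrDr mulr_sumr -[leLHS]addr0; apply: lerD.
  by apply: ler_sum => i _; apply: ler_wpM2r => //; exact: le_bigmax.
exact: mulr_ge0.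
Qed.

(** * The attractor *)

Theorem theorem1 (R : realType) (m : nat) (f : R -> R) (hf : continuous f)
    (b : R) (hb : `|b| < 1)
    (a : R) (a_ : 'I_m -> R) (ha_ : forall i : 'I_m, `|a_ i| < a)
    (ha0 : 0 < a) (ha1 : a < 1)
    (am ap : R) (hamp : am < ap)
    (alpha : R) (halpha : alpha = Num.max `|am| `|ap|)
    (gamma : R) (hgamma : gamma = alpha * `|b| / (1 - a))
    (hgamma0 : 0 < gamma)
    (hbound : forall x : R, am < x < ap -> am + gamma <= f x <= ap - gamma) :
  exists2 A : set (R * 'rV[R]_m.+1),
    is_attractor (delay_map f b a_) (box am ap gamma) A
    & A `<=` box am ap gamma.
Proof.
pose T := delay_map f b a_.
pose K : set (R * 'rV[R]_m.+1) := closed_box am ap gamma.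
pose D : set (R * 'rV[R]_m.+1) := box am ap gamma.
have gammaE : `|b| * alpha + a * gamma = gamma.
  have a1 : 1 - a != 0 by rewrite subr_eq0 eq_sym lt_eqF.
  have := divfK a1 (alpha * `|b|); rewrite -hgamma; lra.
have alphaP x : am <= x <= ap -> `|x| <= alpha.
  move=> /andP[amx xap]; rewrite halpha ler_norml le_max lerNl le_max.
  have := ler_norm ap; have := ler_norm (- am); rewrite normrN => am1 ap1.
  rewrite (le_trans xap ap1) orbT andbT.
  by apply/orP; left; apply: le_trans am1; rewrite lerN2.
have fbound := continuous_itvoo_bounds hf hamp hbound.
have DK : D `<=` K.
  by move=> p [/andP[/ltW l /ltW r] /ltW y]; split=> //; rewrite l.
have Ty p : K p -> norm1 (T p).2 < gamma.
  move=> [/alphaP px py].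
  exact: (norm1_delay_map_lt _ ha0 ha_ hgamma0 gammaE).
have TK p : K p -> K (T p).
  move=> Kp; split; last exact/ltW/Ty.
  case: Kp => /fbound/andP[fl fr] py.
  have := le_trans (ler_sum_norm1 p.2) py; rewrite ler_norml => /andP[sl sr].
  by apply/andP; split; rewrite /=; lra.
have TKD p : K p -> norm1 p.2 < gamma -> D (T p).
  move=> Kp py; split; last exact/Ty.
  case: Kp => /fbound/andP[fl fr] _.
  have := le_lt_trans (ler_sum_norm1 p.2) py; rewrite ltr_norml => /andP[sl sr].
  by apply/andP; split; rewrite /=; lra.
apply: (@attractor_of_absorbing_compact _ _ T D K 2).
- exact: (@norm_hausdorff R (R * 'rV[R]_m.+1)%type).
- exact: continuous_delay_map.
- exact: compact_closed_box.
- exists (am, 0); split=> /=; first by rewrite lexx ltW.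
  by rewrite /norm1 big1 ?ltW// => i _; rewrite mxE normr0.
- by move=> _ [p Kp <-]; exact: TK.
- exact: DK.
- by move=> _ [p Dp <-]; apply: TKD; [exact: DK|case: Dp].
- by move=> _ [p Kp <-]; apply: TKD; [exact: TK|exact: Ty].
Qed.
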